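(* Let $(X,T)$ be a topological dynamical system, where $T$ is a homeomorphism of a compact metric space $X$. The following conditions are equivalent: (1) There exists a uniform generator $\mathcal P$ in $(X,T)$, of cardinality $\ell$. (2) There exists a symbolic extension $\pi:(Y,S)\to(X,T)$ over an alphabet of cardinality $\ell$, which admits an equivariant measurable selector from preimages, i.e., a measurable map $\psi:X\to Y$ such that (a) $\psi\circ T=S\circ\psi$, and (b) $\pi\circ\psi=\mathrm{Id}_X$. (Terminology: since $\psi$ is a measurable embedding of $(X,T)$ into $(Y,S)$, such a $\pi$, or the system $(Y,S)$, is called a symbolic extension with an embedding.)
   Context: A null set of $(X,T)$ is a set of measure zero for all $T$-invariant Borel probability measures. A set is called measurable if it belongs to the completion of the Borel sigma-algebra with respect to the sigma-ideal of null sets; maps and partitions are measurable in this sense. A uniform generator in $(X,T)$ is a finite measurable partition $\mathcal P$ of $X$ such that $\lim_n \mathrm{diam}(\mathcal P^{[-n,n]})=0$, where $\mathcal P^{[-n,n]}=\bigvee_{i=-n}^{n}T^i\mathcal P$ and $\mathrm{diam}(\mathcal Q)$ denotes the maximal diameter of an atom of a partition $\mathcal Q$. A subshift over a finite alphabet $\Lambda$ is a system $(Y,S)$, where $Y\subset\Lambda^{\mathbb Z}$ is closed and shift-invariant, and $S$ is the shift map $(Sy)_n=y_{n+1}$. A symbolic extension of $(X,T)$ is a subshift $(Y,S)$ together with a topological factor map $\pi:(Y,S)\to(X,T)$, i.e., a continuous surjection $\pi:Y\to X$ satisfying $\pi\circ S=T\circ\pi$. *)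

(* Defs.v *)
From HB Require Import structures.
From mathcomp Require Import all_boot all_order all_algebra.
From mathcomp Require Import all_classical all_reals all_analysis.

Set Implicit Arguments.
Unset Strict Implicit.
Unset Printing Implicit Defensive.

Import Order.TTheory GRing.Theory Num.Theory.

Local Open Scope classical_set_scope.
Local Open Scope ring_scope.

(* The library only equips pointed types with sigma-algebras and measures; for
   a space this amounts to being nonempty. *)
#[short(type="pmetricType")]
HB.structure Definition PointedMetric (R : numDomainType) :=
  {M of Metric R M & Pointed M}.

Definition homeomorphism {X Y : topologicalType} (f : X -> Y) : Prop :=
  continuous f /\
  exists g : Y -> X, [/\ continuous g, cancel f g & cancel g f].

Section MeasurabilityUpToNullSets.
Context {R : realType} {X : pmetricType R}.
Implicit Types (T : X -> X) (A N : set X).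

Definition invariant_measure T
    (mu : probability (g_sigma_algebraType (@open X)) R) : Prop :=
  forall A, (@open X).-sigma.-measurable A -> mu (T @^-1` A) = mu A.

(* N need not be Borel: measure zero for mu means being contained in a Borel
   set of mu-measure zero, and that Borel set may depend on mu. *)
Definition null_set T N : Prop :=
  forall mu : probability (g_sigma_algebraType (@open X)) R,
    invariant_measure T mu -> mu.-negligible N.

(* Completion of the Borel sigma-algebra with respect to the null sets. *)
Definition completion_measurable T A : Prop :=
  exists B : set X, (@open X).-sigma.-measurable B /\ null_set T (A `+` B).

Definition completion_measurable_fun T (Y : topologicalType) (f : X -> Y) :
    Prop :=
  forall B : set Y, <<s @open Y >> B -> completion_measurable T (f @^-1` B).

End MeasurabilityUpToNullSets.

Section UniformGenerators.
Context {R : realType} {X : pmetricType R}.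
Implicit Types (T : X -> X) (A : set X) (Q : set (set X)).

(* T^i A for i : int and T bijective; Negz n stands for - n.+1. *)
Definition zimage T (i : int) A : set X :=
  match i with
  | Posz n => iter n T @` A
  | Negz n => iter n.+1 T @^-1` A
  end.

(* A partition of cardinality l is a family of l disjoint labelled sets, some of
   which may be empty: an alphabet of cardinality l may also contain symbols
   that do not occur in the subshift. *)
Definition measurable_partition T (l : nat) (P : 'I_l -> set X) : Prop :=
  [/\ forall k, completion_measurable T (P k),
      trivIset [set: 'I_l] P &
      \bigcup_k P k = [set: X]].

(* The atoms of the join of the partitions T^i P over -n <= i <= n. *)
Definition two_sided_join T (l : nat) (P : 'I_l -> set X) (n : nat) :
    set (set X) :=
  [set \bigcap_(i in [set i : int | - n%:Z <= i <= n%:Z]) zimage T i (P (a i))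
     | a in [set: int -> 'I_l]].

(* Here diam set0 = -oo, so empty atoms do not contribute to the mesh. *)
Definition diam A : \bar R :=
  ereal_sup [set (mdist p.1 p.2)%:E | p in A `*` A].

Definition mesh Q : \bar R := ereal_sup [set diam A | A in Q].

Definition uniform_generator T (l : nat) (P : 'I_l -> set X) : Prop :=
  measurable_partition T P /\
  mesh (two_sided_join T P n) @[n --> \oo] --> 0%E.

End UniformGenerators.

Section SymbolicExtensions.

Definition bisequence (L : finType) : Type :=
  {ptws int -> discrete_topology L}.

HB.instance Definition _ (L : finType) :=
  Topological.copy (bisequence L) {ptws int -> discrete_topology L}.

Definition shift {L : finType} (y : bisequence L) : bisequence L :=
  fun n => y (n + 1).

Definition subshift {L : finType} (Y : set (bisequence L)) : Prop :=
  closed Y /\ shift @` Y = Y.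

(* The factor map is pi restricted to Y; its values outside Y are irrelevant. *)
Definition symbolic_extension {X : topologicalType} (T : X -> X) {L : finType}
    (Y : set (bisequence L)) (pi : bisequence L -> X) : Prop :=
  [/\ subshift Y,
      {within Y, continuous pi},
      pi @` Y = [set: X] &
      forall y, Y y -> pi (shift y) = T (pi y)].

(* As psi takes its values in Y and the Borel sets of Y are the traces of those
   of the full shift, measurability of psi into Y is measurability into the
   full shift. *)
Definition equivariant_measurable_selector {R : realType} {X : pmetricType R}
    (T : X -> X) {L : finType} (Y : set (bisequence L))
    (pi : bisequence L -> X) (psi : X -> bisequence L) : Prop :=
  [/\ forall x, Y (psi x),
      completion_measurable_fun T psi,
      psi \o T = shift \o psi &
      pi \o psi = id].

End SymbolicExtensions.

(* Main.v *)
(** Send a point to its itinerary through the generator. Points whose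
    itineraries agree on [-n, n] lie in one atom of the join over [-n, n], so
    the inverse of the itinerary map is uniformly continuous and extends to a
    factor map on the closure of the set of itineraries, of which the itinerary
    map is a selector. Conversely, the factor map of a symbolic extension is
    uniformly continuous by compactness, so the partition of [X] according to
    the zeroth symbol of the selector is a uniform generator. *)

Require Import Defs.
From HB Require Import structures.
From mathcomp Require Import all_boot all_order all_algebra.
From mathcomp Require Import all_classical all_reals all_analysis.
From mathcomp Require Import zify lra.

Set Implicit Arguments.
Unset Strict Implicit.
Unset Printing Implicit Defensive.

Import Order.TTheory GRing.Theory Num.Theory.

Local Open Scope classical_set_scope.
Local Open Scope ring_scope.

(** * Topology of the full shift through central windows *)

Definition agree (A : Type) (n : nat) (y z : int -> A) : Prop :=
  forall i : int, (`|i| <= n)%N -> y i = z i.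

Lemma agree_sym (A : Type) n (y z : int -> A) : agree n y z -> agree n z y.
Proof. by move=> yz i /yz. Qed.

Lemma agree_trans (A : Type) n (y x z : int -> A) :
  agree n x y -> agree n y z -> agree n x z.
Proof. by move=> xy yz i ni; rewrite xy // yz. Qed.

Lemma agreeW (A : Type) m n (y z : int -> A) :
  (m <= n)%N -> agree n y z -> agree m y z.
Proof. by move=> mn yz i im; apply: yz; exact: leq_trans mn. Qed.

Lemma nbhs_coordinate (L : finType) (i : int) (y : bisequence L) :
  nbhs y [set z : bisequence L | z i = y i].
Proof.
have yi : nbhs (proj i y : discrete_topology L) [set proj i y].
  exact: discrete_set1.
exact: (@proj_continuous int (fun=> discrete_topology L) i y _ yi).
Qed.

Lemma nbhs_agree (L : finType) (n : nat) (y : bisequence L) :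
  nbhs y [set z : bisequence L | agree n y z].
Proof.
(* Splitting the window by sign lets an induction on its length add the coordinates [m] and [- m]
   together. *)
have : nbhs y [set z : bisequence L | forall k : nat, (k < n.+1)%N ->
    z (Posz k) = y (Posz k) /\ z (- Posz k) = y (- Posz k)].
  elim: n.+1 => [|m IH]; first by apply: filterS filterT.
  apply: filterS (filterI IH (filterI (nbhs_coordinate (Posz m) y)
    (nbhs_coordinate (- Posz m) y))) => z [zy [zm zNm]] k.
  by rewrite ltnS leq_eqVlt => /orP[/eqP -> | /zy].
apply: filterS => z zy [k|k] kn; first by have [] := zy k kn.
by rewrite NegzE; have [] := zy k.+1 kn.
Qed.

(** The product topology is the supremum of the topologies induced by the coordinates, so the filter
    generated by windows around [y] converges to [y] once each coordinate [i] is controlled; the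
    window of radius [|i|] does that. *)
Lemma nbhs_bisequenceP (L : finType) (y : bisequence L)
    (U : set (bisequence L)) :
  nbhs y U <-> exists n, forall z, agree n y z -> U z.
Proof.
split=> [yU|[n nU]]; last exact: filterS (nbhs_agree n y).
pose F := filter_from [set: nat]
  (fun n => [set z : bisequence L | agree n y z]).
have FF : Filter F.
  apply: filter_from_filter; first by exists 0%N.
  move=> m n _ _; exists (maxn m n) => // z yz.
  by split; apply: agreeW yz; rewrite ?leq_maxl ?leq_maxr.
have /(_ U yU) [n _ nU] : F --> y.
  apply/(@cvg_sup _ _ _ F y) => i U' [V [[W oW <-] Wy] VU'].
  exists `|i|%N => // z yz; apply: VU'; rewrite /= /proj -yz //.
by exists n.
Qed.

Lemma compact_bisequence (L : finType) : compact [set: bisequence L].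
Proof.
have -> : [set: bisequence L] =
    [set f : forall i : int, L | forall i, setT (f i)].
  by apply/seteqP; split.
apply: (@tychonoff int (fun=> discrete_topology L) (fun=> setT)) => _.
by apply: finite_compact; apply: (@finite_finset L setT).
Qed.

(** * Integer iterates of an invertible map *)

Section IntIter.
Variables (X : Type) (T g : X -> X) (TK : cancel T g) (gK : cancel g T).

Definition int_iter (i : int) (x : X) : X :=
  match i with
  | Posz n => iter n T x
  | Negz n => iter n.+1 g x
  end.

Lemma int_iterS i x : int_iter (i + 1) x = int_iter i (T x).
Proof.
case: i => [n|[|n]]; first by rewrite -PoszD addn1 /int_iter iterSr.
  by rewrite /= TK.
have -> : Negz n.+1 + 1 = Negz n by lia.
by rewrite /int_iter [RHS]iterSr TK.
Qed.

(** Induction on the size of [i]; for negative [i], writing [x] as [T (g x)] raises the index by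
    one. *)
Lemma int_iter_equivariant (L : finType) (f : X -> bisequence L) :
  f \o T = Defs.shift \o f -> forall x i, f x i = f (int_iter i x) 0.
Proof.
move=> fT; have fS x i : f (T x) i = f x (i + 1).
  by rewrite -[LHS]/((f \o T) x i) fT.
move=> x [n|n].
  elim: n x => [//|n IH] x.
  by rewrite -addn1 PoszD int_iterS -fS IH.
elim: n x => [|n IH] x; first by rewrite -[in LHS](gK x) fS.
rewrite -[in LHS](gK x) fS; have -> : Negz n.+1 + 1 = Negz n by lia.
by rewrite IH /int_iter [in RHS]iterSr.
Qed.

End IntIter.

(** A forward image under a bijection is a preimage under its inverse, hence the sign change.
    Membership in an atom of a join thus becomes a condition on the orbit. *)
Lemma zimageE (R : realType) (X : pmetricType R) (T g : X -> X) i (A : set X) :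
  cancel T g -> cancel g T -> zimage T i A = int_iter T g (- i) @^-1` A.
Proof.
move=> TK gK.
have TnK n : cancel (iter n T) (iter n g).
  by elim: n => [//|n IH] x; rewrite iterSr iterS TK IH.
have gnK n : cancel (iter n g) (iter n T).
  by elim: n => [//|n IH] x; rewrite iterSr iterS gK IH.
case: i => n /=; last by [].
have -> : int_iter T g (- Posz n) = iter n g by case: n.
apply/seteqP; split=> [_ [x Ax <-]|x Ax]; first by rewrite /= TnK.
by exists (iter n g x) => //; exact: gnK.
Qed.

(** * The mesh of the joins in terms of itineraries *)

Section Mesh.
Variables (R : realType) (X : pmetricType R) (T g : X -> X).
Variables (l : nat) (P : 'I_l -> set X) (f : X -> int -> 'I_l).
Hypotheses (TK : cancel T g) (gK : cancel g T).
Hypothesis fP : forall x i k, P k (int_iter T g i x) <-> f x i = k.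

Lemma two_sided_join_agree n A x x' :
  two_sided_join T P n A -> A x -> A x' -> agree n (f x) (f x').
Proof.
move=> [a _ <-] ax ax' i ni.
have ni' : - n%:Z <= - i <= n%:Z by lia.
have := ax _ ni'; have := ax' _ ni'.
by rewrite (zimageE _ _ TK gK) /= opprK => /fP -> /fP ->.
Qed.

Lemma two_sided_join_ex n x :
  exists2 A, two_sided_join T P n A & forall x', agree n (f x) (f x') -> A x'.
Proof.
(* The cell at time [i] of the join constrains coordinate [- i] of the itinerary. *)
eexists; first by exists (fun i => f x (- i)).
move=> x' xx' i ni; rewrite (zimageE _ _ TK gK); apply/fP.
by rewrite xx' //; move: ni => /=; lia.
Qed.

(** Points of one atom agree on the window, and agreeing points share an atom. Agreement on a longer
    window is stronger, so one good window per [e] already yields the limit. *)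
Lemma mesh_two_sided_joinP :
  mesh (two_sided_join T P n) @[n --> \oo] --> 0%E <->
  forall e : R, 0 < e ->
    exists n, forall x x', agree n (f x) (f x') -> mdist x x' < e.
Proof.
have le_mesh n x x' : agree n (f x) (f x') ->
    ((mdist x x')%:E <= mesh (two_sided_join T P n))%E.
  move=> xx'; have [A nA xA] := two_sided_join_ex n x.
  apply: le_trans (_ : diam A <= _)%E; last first.
    by apply: ereal_sup_ubound; exists A.
  by apply: ereal_sup_ubound; exists (x, x') => //; split; exact: xA.
(* Suprema over empty sets are [-oo]; the atom containing [point] keeps the mesh nonnegative. *)
have mesh_ge0 n : (0 <= mesh (two_sided_join T P n))%E.
  apply: le_trans (le_mesh n point point _); last by [].
  by rewrite lee_fin mdist_ge0.
split=> [cvg0 e e0|small].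
  have /cvg0[n _ /(_ n) ne] : nbhs 0%E [set x : \bar R | (x < e%:E)%E].
    apply: open_nbhs_nbhs; split; first exact: open_ereal_lt_ereal.
    by rewrite /= lte_fin.
  exists n => x x' /le_mesh xx'; rewrite -lte_fin.
  by apply: le_lt_trans xx' _; apply: ne => /=.
have mesh_le e : 0 < e ->
    \forall n \near \oo, (mesh (two_sided_join T P n) <= e%:E)%E.
  move=> /small[m me]; exists m => // n /= mn.
  apply: ub_ereal_sup => _ [A nA <-].
  apply: ub_ereal_sup => _ [[x x'] [/= Ax Ax'] <-].
  rewrite lee_fin ltW //; apply: me; apply: agreeW mn _.
  exact: two_sided_join_agree nA _ _.
(* The mesh is an extended real: eventual finiteness comes first, from the bound for [e = 1]. *)
apply/fine_cvgP; split.
  apply: filterS (mesh_le 1 ltr01) => n n1.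
  by rewrite ge0_fin_numE //; apply: le_lt_trans n1 (ltry _).
apply/cvgrPdist_le => e e0; apply: filterS (mesh_le e e0) => n ne.
rewrite sub0r normrN ger0_norm ?fine_ge0 // -lee_fin fineK //.
by rewrite ge0_fin_numE //; apply: le_lt_trans ne (ltry _).
Qed.

End Mesh.

(** * Measurability up to null sets *)

Section Completion.
Variables (R : realType) (X : pmetricType R) (T : X -> X).
Implicit Types (A N : set X).

Lemma null_set_bigcup (N : (set X)^nat) :
  (forall n, Defs.null_set T (N n)) -> Defs.null_set T (\bigcup_n N n).
Proof. by move=> N0 mu muT; apply: negligible_bigcup => n; exact: N0. Qed.

Lemma null_setS A N : A `<=` N -> Defs.null_set T N -> Defs.null_set T A.
Proof. by move=> AN N0 mu muT; apply: negligibleS (N0 mu muT). Qed.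

Lemma borel_preimage (h : X -> X) A : continuous h ->
  (@open X).-sigma.-measurable A -> (@open X).-sigma.-measurable (h @^-1` A).
Proof.
move=> hc mA.
have hm : measurable_fun [set: g_sigma_algebraType (@open X)]
    (h : g_sigma_algebraType (@open X) -> g_sigma_algebraType (@open X)).
  apply: (@measurability _ _ (g_sigma_algebraType (@open X))
    (g_sigma_algebraType (@open X)) setT h (@open X) erefl) => _ [B oB <-].
  rewrite setTI; apply: sub_sigma_algebra.
  by apply: open_comp => // x _; exact: hc.
by rewrite -[_ @^-1` _]setTI; exact: hm.
Qed.

(** Complementing both sets preserves their symmetric difference, and the symmetric difference of
    two unions lies in the union of the symmetric differences. *)
Lemma completion_measurable_sigma_algebra :
  sigma_algebra setT (completion_measurable T).
Proof.
split.
- exists set0; split; first exact: measurable0.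
  by move=> mu _; exists set0; split=> [||x [] []]; rewrite ?measure0.
- move=> A [B [mB AB]]; exists (~` B); rewrite setTD; split.
    exact: measurableC.
  apply: null_setS AB => x; rewrite /setY /setD /setU /setC /=.
  case=> -[Ax nBx]; [right|left]; split=> //; exact: contrapT.
- move=> A /choice[B AB]; exists (\bigcup_n B n); split.
    by apply: bigcupT_measurable => n; have [] := AB n.
  have := @null_set_bigcup (fun n => A n `+` B n) (fun n => (AB n).2).
  apply: null_setS => x [[[n _ Anx] nB]|[[n _ Bnx] nA]]; exists n => //.
    by left; split => // Bnx; apply: nB; exists n.
  by right; split => // Anx; apply: nA; exists n.
Qed.

(** Invariance under [h] makes the preimage of a [mu]-null Borel cover [mu]-null again. A general
    [h] covers both [T] and its inverse. *)
Lemma completion_measurable_preimage (h : X -> X) A : continuous h ->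
  (forall mu : probability (g_sigma_algebraType (@open X)) R,
    invariant_measure T mu -> invariant_measure h mu) ->
  completion_measurable T A -> completion_measurable T (h @^-1` A).
Proof.
move=> hc hinv [B [mB AB]]; exists (h @^-1` B); split.
  exact: borel_preimage.
move=> mu muT; have [N [mN N0 ABN]] := AB mu muT.
exists (h @^-1` N); split; first exact: borel_preimage.
  by rewrite hinv.
by move=> x /ABN.
Qed.

(** The sets with measurable preimage form a sigma-algebra, which reduces the claim to open sets. *)
Lemma completion_measurable_bisequence (L : finType) (f : X -> bisequence L) :
  (forall i k, completion_measurable T [set x | f x i = k]) ->
  completion_measurable_fun T f.
Proof.
have [cm0 cmC cmU] := completion_measurable_sigma_algebra.
have cmN A : completion_measurable T A -> completion_measurable T (~` A).
  by rewrite -setTD; exact: cmC.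
have cmI A B : completion_measurable T A -> completion_measurable T B ->
    completion_measurable T (A `&` B).
  move=> cA cB; rewrite -[A]setCK -[B]setCK -setCU -bigcup2E; apply: (cmN).
  by apply: (cmU) => -[|[|n]] /=; [exact: cmN|exact: cmN|].
move=> fm; apply: smallest_sub; first split.
- by rewrite /= preimage_set0.
- by move=> A cA /=; rewrite setTD preimage_setC; exact: cmN.
- by move=> A cA /=; rewrite preimage_bigcup; exact: cmU.
move=> U oU /=.
(* Cylinders, coded by finite lists of prescribed coordinates, form a countable
   basis of the full shift. *)
pose cyl (s : seq (int * L)) := [set x | all (fun p => f x p.1 == p.2) s].
have cylm s : completion_measurable T (cyl s).
  elim: s => [|p s IH].
    have -> : cyl [::] = ~` set0 by rewrite setC0; apply/seteqP; split.
    exact: cmN.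
  have -> : cyl (p :: s) = [set x | f x p.1 = p.2] `&` cyl s.
    by apply/seteqP; split=> [x /andP[/eqP]|x [/eqP xp xs]] //; apply/andP.
  exact: cmI.
(* Codes of no list, and cylinders not inside the preimage of [U], contribute the empty set. *)
pose C n := if unpickle n is Some s then
  if `[< cyl s `<=` f @^-1` U >] then cyl s else set0 else set0.
have -> : f @^-1` U = \bigcup_n C n.
  apply/seteqP; split=> [x Ux|x [n _]]; last first.
    by rewrite /C; case: unpickle => // s; case: asboolP => // sU /sU.
  have /nbhs_bisequenceP[n nU] : nbhs (f x) U by exact: open_nbhs_nbhs.
  pose s := [seq (i, f x i) | i <- [seq Posz k | k <- iota 0 n.+1] ++
    [seq - Posz k | k <- iota 0 n.+1]].
  exists (pickle s) => //; rewrite /C pickleK asboolT.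
    by apply/allP => _ /mapP[i _ ->] /=.
  move=> z /allP sz; apply: nU => i ni.
  apply/esym/eqP; apply: (sz (i, f x i)); apply: map_f; rewrite mem_cat.
  case: i ni => k kn; apply/orP; [left|right].
    by apply: map_f; rewrite mem_iota.
  by apply/mapP; exists k.+1; rewrite ?NegzE ?mem_iota.
apply: (cmU) => n; rewrite /C; case: unpickle => // s.
by case: ifP.
Qed.

End Completion.

(** * Extending the inverse of the itinerary map *)

Section Decoding.
Variables (R : realType) (X : pmetricType R) (L : finType).
Variable f : X -> bisequence L.
Hypothesis compactX : compact [set: X].
Hypothesis f_separates : forall e : R, 0 < e ->
  exists n, forall x x', agree n (f x) (f x') -> mdist x x' < e.

Definition fiber (y : bisequence L) (n : nat) : set X :=
  [set x | agree n (f x) y].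

Lemma closure_rangeP y : closure (range f) y <-> forall n, fiber y n !=set0.
Proof.
split=> [yf n|yf U /nbhs_bisequenceP[n nU]].
  by have [_ [[x _ <-] /agree_sym xy]] := yf _ (nbhs_agree n y); exists x.
by have [x /agree_sym xy] := yf n; exists (f x); split; [exists x|exact: nU].
Qed.

(** Closures are taken because [f] is not assumed continuous, so fibers need not be closed. On
    [closure (range f)] the intersection is a single point; [point] is a default for empty
    intersections. *)
Definition decode (y : bisequence L) : X :=
  xget point (\bigcap_n closure (fiber y n)).

(** The nested nonempty fibers generate a proper filter; by compactness it has a cluster point,
    which lies in every closure. *)
Lemma decodeP y n : closure (range f) y -> closure (fiber y n) (decode y).
Proof.
move=> /closure_rangeP yf.
have FF : ProperFilter (filter_from [set: nat] (fiber y)).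
  apply: filter_from_proper => [|m _]; last exact: yf.
  apply: filter_from_filter; first by exists 0%N.
  move=> i j _ _; exists (maxn i j) => // x xy.
  by split; apply: agreeW xy; rewrite ?leq_maxl ?leq_maxr.
have [p [_ pF]] := compactX FF filterT.
have /(xgetPex point) : (\bigcap_n closure (fiber y n)) !=set0; last by apply.
by exists p => m _ U pU; apply: pF => //; exists m.
Qed.

(** One third of [e] bounds distances inside the fiber, and the other two pay for moving [p] and [q]
    into it. The radius [n] does not depend on [y]. *)
Lemma diam_closure_fiber (e : R) : 0 < e -> exists n, forall y p q,
  closure (fiber y n) p -> closure (fiber y n) q -> mdist p q < e.
Proof.
move=> e0; have e30 : 0 < e / 3 by lra.
have [n ne] := f_separates e30; exists n => y p q.
move=> /(_ _ (nbhsx_ballx p _ e30))[x [xy]]; rewrite ballEmdist /= => px.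
move=> /(_ _ (nbhsx_ballx q _ e30))[x' [x'y]]; rewrite ballEmdist /= => qx'.
have xx' : mdist x x' < e / 3 by apply: ne => i ni; rewrite xy // x'y.
have := metric_triangle p x q; have := metric_triangle x x' q.
rewrite (metric_sym x' q); lra.
Qed.

(** If the two points differed, their own distance could serve as [e] in [diam_closure_fiber]. *)
Lemma decode_eq y p : closure (range f) y ->
  (forall n, closure (fiber y n) p) -> decode y = p.
Proof.
move=> yf yp; apply/eqP; apply: contraT; rewrite -mdist_gt0 => e0.
have [n /(_ _ _ _ (decodeP n yf) (yp n))] := diam_closure_fiber e0.
by rewrite ltxx.
Qed.

Lemma decodeK : decode \o f = id.
Proof.
apply/funext => x /=; apply: decode_eq => [|n]; apply: subset_closure => //.
Qed.

(** Bisequences agreeing on the window have the same fiber, so both decoded points lie in one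
    closure of small diameter. *)
Lemma decode_continuous : {within closure (range f), continuous decode}.
Proof.
apply/subspace_continuousP => y yf; apply/cvg_ballP => e e0.
have [n ne] := diam_closure_fiber e0.
apply: filterS (nbhs_agree n y) => z yz zf; rewrite ballEmdist /=.
apply: (ne y); first exact: decodeP.
suff -> : fiber y n = fiber z n by exact: decodeP.
by apply/seteqP; split=> x xy i ni; rewrite xy // yz.
Qed.

Variables (T g : X -> X).
Hypotheses (Tc : continuous T) (TK : cancel T g) (gK : cancel g T).
Hypothesis fT : f \o T = Defs.shift \o f.

(** [T] and [g] carry fibers to fibers of the shifted bisequence. Each move costs one coordinate at
    an end of the window, hence the radius [n.+1]. *)
Lemma shift_closure_range :
  Defs.shift @` closure (range f) = closure (range f).
Proof.
have fTE x i : f (T x) i = f x (i + 1) by rewrite -[LHS]/((f \o T) x i) fT.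
apply/seteqP; split=> [_ [y /closure_rangeP yf <-]|y /closure_rangeP yf].
  apply/closure_rangeP => n; have [x xy] := yf n.+1.
  by exists (T x) => i ni; rewrite fTE xy //; lia.
exists (fun i => y (i - 1)); last first.
  by apply/funext => i; rewrite /Defs.shift addrK.
apply/closure_rangeP => n; have [x xy] := yf n.+1.
exists (g x) => i ni; rewrite -xy; last by lia.
by rewrite -[in RHS](gK x) fTE subrK.
Qed.

(** By continuity [T (decode y)] lies in the closure of every fiber of the shifted bisequence, and
    such a point is unique. *)
Lemma decode_shift y : closure (range f) y ->
  decode (Defs.shift y) = T (decode y).
Proof.
move=> yf; apply: decode_eq => [|n].
  by rewrite -shift_closure_range; exists y.
move=> U /Tc /(decodeP n.+1 yf)[x [xy xU]]; exists (T x); split=> //.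
by move=> i ni; rewrite -[LHS]/((f \o T) x i) fT /= /Defs.shift xy //; lia.
Qed.

Lemma symbolic_extension_decode :
  symbolic_extension T (closure (range f)) decode.
Proof.
split; [split| | |].
- exact: closed_closure.
- exact: shift_closure_range.
- exact: decode_continuous.
- apply/seteqP; split=> // x _; exists (f x); first exact: subset_closure.
  exact: (congr1 (@^~ x) decodeK).
- exact: decode_shift.
Qed.

End Decoding.

(** * Uniform continuity on subshifts *)

(** The Heine-Cantor argument: a radius that works near each point of [Y] becomes uniform by the
    near-covering form of compactness. Comparing both points with the centre [y] explains
    [e / 2]. *)
Lemma unif_continuous_bisequence (R : realType) (X : metricType R) (L : finType)
    (Y : set (bisequence L)) (h : bisequence L -> X) (e : R) :
  closed Y -> {within Y, continuous h} -> 0 < e ->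
  exists n, forall y z, Y y -> Y z -> agree n y z -> mdist (h y) (h z) < e.
Proof.
move=> Yc hc e0; have e20 : 0 < e / 2 by lra.
have /compact_near_coveringP/near_covering_withinP Yk : compact Y.
  exact: subclosed_compact Yc (@compact_bisequence L) (@subsetT _ _).
pose near_h n (y : bisequence L) :=
  forall z, Y z -> agree n y z -> mdist (h y) (h z) < e.
have [|n _ nY] := Yk nat \oo near_h _; last first.
  by exists n => y z Yy Yz yz; exact: (nY n (leqnn n) y Yy z).
move=> y Yy; have hcy : h @ within Y (nbhs y) --> h y.
  by have /subspace_continuousP := hc; exact.
have /nbhs_bisequenceP[m mh] := hcy _ (nbhsx_ballx (h y) _ e20).
exists ([set z : bisequence L | agree m y z], [set n | (m <= n)%N]).
  by split; [exact: nbhs_agree|exists m].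
move=> [x n] /= [yx mn] Yx z Yz xz.
have := mh x yx Yx; have := mh z (agree_trans yx (agreeW mn xz)) Yz.
rewrite !ballEmdist /= => yz yx'.
have := metric_triangle (h x) (h y) (h z).
rewrite (metric_sym (h x) (h y)); lra.
Qed.

(** * The two implications *)

Section Equivalence.
Variables (R : realType) (X : pmetricType R) (T g : X -> X) (l : nat).
Hypotheses (compactX : compact [set: X]) (Tc : continuous T).
Hypotheses (gc : continuous g) (TK : cancel T g) (gK : cancel g T).

Lemma completion_measurable_int_iter i (A : set X) :
  completion_measurable T A -> completion_measurable T (int_iter T g i @^-1` A).
Proof.
move=> Am; have iterm h n : continuous h ->
    (forall mu : probability (g_sigma_algebraType (@open X)) R,
      invariant_measure T mu -> invariant_measure h mu) ->
    completion_measurable T (iter n h @^-1` A).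
  move=> hc hinv; elim: n => [//|n IH].
  have -> : iter n.+1 h @^-1` A = h @^-1` (iter n h @^-1` A).
    by apply/seteqP; split=> x; rewrite /preimage /mkset iterSr.
  exact: completion_measurable_preimage.
case: i => n; apply: (iterm _ _ _ _) => // mu muT B mB.
(* A [T]-invariant measure is [g]-invariant: pulling the [g]-preimage of [B] back by [T] recovers
   [B]. *)
rewrite -[LHS]muT; last exact: borel_preimage.
by congr (mu _); apply/seteqP; split=> x; rewrite /preimage /= TK.
Qed.

Lemma symbolic_extension_of_generator (P : 'I_l -> set X) :
  uniform_generator T P ->
  exists (Y : set (bisequence 'I_l)) (pi : bisequence 'I_l -> X),
    symbolic_extension T Y pi /\
    exists psi, equivariant_measurable_selector T Y pi psi.
Proof.
move=> [[Pm Pd Pc] mesh0].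
have /choice[c cP] : forall x, exists k, P k x.
  by move=> x; have [k _ Pkx] : (\bigcup_k P k) x; [rewrite Pc|exists k].
have cE x k : P k x <-> c x = k.
  split=> [Pkx|<- //]; apply: (Pd (c x) k) => //.
  by exists x.
pose f x : bisequence 'I_l := fun i => c (int_iter T g i x).
have fE x i k : P k (int_iter T g i x) <-> f x i = k by exact: cE.
have fT : f \o T = Defs.shift \o f.
  apply/funext => x; apply/funext => i.
  by rewrite /= /Defs.shift /f int_iterS.
have sep := (mesh_two_sided_joinP TK gK fE).1 mesh0.
exists (closure (range f)), (decode f); split.
  exact: symbolic_extension_decode gK fT.
exists f; split => //; last exact: decodeK.
- by move=> x; apply: subset_closure; exists x.
apply: completion_measurable_bisequence => i k.
have -> : [set x | f x i = k] = int_iter T g i @^-1` P k.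
  by apply/seteqP; split=> x /fE.
exact: completion_measurable_int_iter.
Qed.

Lemma generator_of_symbolic_extension (L : finType) (Y : set (bisequence L))
    (pi : bisequence L -> X) (psi : X -> bisequence L) :
  #|L| = l -> symbolic_extension T Y pi ->
  equivariant_measurable_selector T Y pi psi ->
  exists P : 'I_l -> set X, uniform_generator T P.
Proof.
move=> Ll [[Yc _] pic _ _] [psiY psim psiT psiK].
(* Cells are indexed by ['I_l], so symbols are relabelled by their rank; injectivity recovers
   agreement of [psi] from that of [f]. *)
pose s (k : L) : 'I_l := cast_ord Ll (enum_rank k).
have s_inj : injective s by move=> k k' /cast_ord_inj/enum_rank_inj.
pose f x (i : int) := s (psi x i).
exists (fun k => [set x | f x 0 = k]); split.
  split=> [k|k k' _ _ [x [/= <- <-]] //|]; last first.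
    by apply/seteqP; split=> // x _; exists (f x 0).
  apply: (psim [set y | s (y 0) = k]); apply: sub_sigma_algebra.
  rewrite openE => y yk; apply: filterS (nbhs_coordinate 0 y) => z /= ->.
  exact: yk.
have fE x i k : f (int_iter T g i x) 0 = k <-> f x i = k.
  by rewrite /f -(int_iter_equivariant TK gK psiT).
apply/(mesh_two_sided_joinP TK gK fE) => e e0.
have [n ne] := unif_continuous_bisequence Yc pic e0.
(* As [psi] is merely measurable, distances in [X] are estimated through the uniformly continuous
   [pi]. *)
have psiKE x : pi (psi x) = x by rewrite -[LHS]/((pi \o psi) x) psiK.
exists n => x x' xx'; rewrite -(psiKE x) -(psiKE x'); apply: ne => // i ni.
by apply: s_inj; exact: xx'.
Qed.

End Equivalence.

Theorem theorem1p2 (R : realType) (X : pmetricType R) (T : X -> X)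
    (compactX : compact [set: X]) (homeoT : homeomorphism T) (l : nat) :
  (exists P : 'I_l -> set X, uniform_generator T P) <->
  (exists (L : finType) (Y : set (bisequence L)) (pi : bisequence L -> X),
     [/\ #|L| = l,
         symbolic_extension T Y pi &
         exists psi : X -> bisequence L,
           equivariant_measurable_selector T Y pi psi]).
Proof.
have [Tc [g [gc TK gK]]] := homeoT.
split=> [[P Pgen]|[L [Y [pi [Ll Ypi [psi Ypsi]]]]]].
  have [Y [pi [Ypi Ypsi]]] :=
    symbolic_extension_of_generator compactX Tc gc TK gK Pgen.
  by exists 'I_l, Y, pi; split=> //; rewrite card_ord.
exact: generator_of_symbolic_extension TK gK _ _ _ _ Ll Ypi Ypsi.
Qed.
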